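(* Consider integers $n\ge 0$, $l\ge 1$ and $b$ with $2 \leq b \leq 10$. \begin{enumerate} \item The only solution $(n,b,l)$ of $\mathcal{P}_{n} = (b+1)b^l-1$ is $(7,2,1)$; thus the only Thabit number of the first kind base $b$ (for $2\le b\le 10$) which is a Padovan number is $5$. \item The solutions $(n,b,l)$ of $\mathcal{P}_{n} = (b+1)b^l+1$ are exactly $(8, 2, 1), (12, 4, 1), (14, 3, 2), (15, 2, 4), (19, 5, 2)$; thus the Thabit numbers of the second kind base $b$ which are Padovan numbers are $7, 21, 37, 49, 151$. \item The solutions $(n,b,l)$ of $\mathcal{P}_{n} = (b-1)b^l-1$ are exactly $(0, 2, 1), (1, 2, 1), (2, 2, 1), (5, 2, 2), (7, 3, 1), (8, 2, 3)$; thus the Williams numbers of the first kind base $b$ which are Padovan numbers are $1, 3, 5, 7$. \item The solutions $(n,b,l)$ of $\mathcal{P}_{n} = (b-1)b^l+1$ are exactly $(5, 2, 1), (7, 2, 2), (8, 3, 1), (9, 2, 3), (12, 5, 1), (15, 4, 2), (16, 2, 6), (26, 6, 3)$; thus the Williams numbers of the second kind base $b$ which are Padovan numbers are $3, 5, 7, 9, 21, 49, 65, 1081$. \end{enumerate}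
   Context: $(\mathcal{P}_n)_{n\ge 0}$ denotes the Padovan sequence: $\mathcal{P}_0=\mathcal{P}_1=\mathcal{P}_2=1$ and $\mathcal{P}_{n+3}=\mathcal{P}_{n+1}+\mathcal{P}_n$ for all $n\ge 0$. For an integer $b\ge 2$ and $l\ge 1$: a Thabit number of the first kind base $b$ is $(b+1)b^l-1$, of the second kind is $(b+1)b^l+1$; a Williams number of the first kind base $b$ is $(b-1)b^l-1$, of the second kind is $(b-1)b^l+1$. *)

(* Defs.v *)
From mathcomp Require Import all_boot.

Set Implicit Arguments.
Unset Strict Implicit.
Unset Printing Implicit Defensive.

Fixpoint padovan (n : nat) : nat :=
  match n with
  | ((k.+1) as k1).+2 => padovan k1 + padovan k
  | _ => 1
  end.

Lemma padovan_init : [/\ padovan 0 = 1, padovan 1 = 1 & padovan 2 = 1].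
Proof. by []. Qed.

Lemma padovan_rec n : padovan n.+3 = padovan n.+1 + padovan n.
Proof. by []. Qed.

(* The truncated subtractions below are exact whenever 2 <= b. *)
Definition thabit1 (b l : nat) : nat := (b + 1) * b ^ l - 1.
Definition thabit2 (b l : nat) : nat := (b + 1) * b ^ l + 1.
Definition williams1 (b l : nat) : nat := (b - 1) * b ^ l - 1.
Definition williams2 (b l : nat) : nat := (b - 1) * b ^ l + 1.

Definition is_padovan (m : nat) : Prop := exists n, m = padovan n.

(* [f] is one of the four families above. *)
Definition is_value_small_base (f : nat -> nat -> nat) (m : nat) : Prop :=
  exists b l : nat, [/\ 2 <= b <= 10, 1 <= l & m = f b l].

(* Main.v *)
(** Each equation reads P_n + d = c b^l + e with c = b + 1 or b - 1 and
    (d, e) = (1, 0) or (0, 1).  Modulo any m the left-hand side is periodic in n,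
    and so is the right-hand side in l when m is coprime to b, so m leaves only
    some pairs of residue classes for (n, l).  Once l >= l0, a prime power
    dividing b^l0 moreover fixes P_n modulo itself, and combining it with a few
    well-chosen moduli leaves no pair at all.  The threshold l0 has to exceed the
    exponent of every solution, including those with n < 0 for the Padovan
    sequence extended backwards, which no congruence can exclude: for instance
    P_(-54) = 3 * 2^8 + 1 and P_(-62) = 3 * 2^8 - 1. *)

From Stdlib Require Import NArith.
Require Import Defs.
From mathcomp Require Import all_boot.
From mathcomp Require Import zify.

Set Implicit Arguments.
Unset Strict Implicit.
Unset Printing Implicit Defensive.

Lemma modn_period (A : Type) (f : nat -> A) T :
  (forall n, f (n + T) = f n) -> forall n, f n = f (n %% T).
Proof.
move=> fT n; rewrite {1}(divn_eq n T) addnC.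
elim: (n %/ T) => [|k IH]; first by rewrite addn0.
by rewrite mulSn (addnC T) addnA fT.
Qed.

(** * Residues of the Padovan and geometric sequences *)

Section Residues.

Local Open Scope N_scope.

(** Serves only in statements: the computation itself runs on the tables below, in binary arithmetic
    with reduced residues. *)
Definition padovanN (n : nat) : N := N.of_nat (padovan n).

Lemma padovanN_rec n : padovanN n.+3 = padovanN n + padovanN n.+1.
Proof. by rewrite /padovanN padovan_rec; lia. Qed.

Fixpoint padovan_table (m : N) (k : nat) (x y z : N) : seq N :=
  if k is k'.+1 then x :: padovan_table m k' y z ((x + y) mod m) else [::].

Lemma nth_padovan_table m k i j : (j < k)%N ->
  nth 0 (padovan_table m k (padovanN i mod m) (padovanN i.+1 mod m)
                           (padovanN i.+2 mod m)) j =
  padovanN (i + j) mod m.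
Proof.
elim: k i j => // k IH i [|j] /= ltjk; first by rewrite addn0.
by rewrite -N.Div0.add_mod -padovanN_rec IH // addSnnS.
Qed.

Fixpoint geometric_table (m b : N) (k : nat) (x : N) : seq N :=
  if k is k'.+1 then x :: geometric_table m b k' ((x * b) mod m) else [::].

Lemma nth_geometric_table m b k c j : (j < k)%N ->
  nth 0 (geometric_table m b k (c mod m)) j = (c * b ^ N.of_nat j) mod m.
Proof.
elim: k c j => // k IH c [|j] ltjk; first by rewrite N.mul_1_r.
rewrite Nat2N.inj_succ N.pow_succ_r' N.mul_assoc -IH //=.
by rewrite N.Div0.mul_mod_idemp_l.
Qed.

(** The recurrence has order three, so agreement of three consecutive terms with the first three
    propagates to all later ones. *)
Lemma padovan_residue_period m T :
  (forall i, (i < 3)%N -> padovanN (T + i) mod m = padovanN i mod m) ->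
  forall n, padovanN n mod m = padovanN (n %% T)%N mod m.
Proof.
move=> H; apply: (@modn_period _ (fun n => padovanN n mod m)) => n.
suff [] : [/\ padovanN (n + T) mod m = padovanN n mod m,
              padovanN (n.+1 + T) mod m = padovanN n.+1 mod m
            & padovanN (n.+2 + T) mod m = padovanN n.+2 mod m] by [].
elim: n => [|n [IH0 IH1 IH2]]; first by split; rewrite addnC H.
split=> //; rewrite !addSn !padovanN_rec N.Div0.add_mod -!addSn IH0 IH1.
by rewrite -N.Div0.add_mod.
Qed.

Lemma geometric_residue_period m b c o :
  (c * b ^ N.of_nat o) mod m = c mod m ->
  forall l, (c * b ^ N.of_nat l) mod m = (c * b ^ N.of_nat (l %% o)%N) mod m.
Proof.
move=> H; apply: (@modn_period _ (fun l => (c * b ^ N.of_nat l) mod m)) => l.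
have -> : c * b ^ N.of_nat (l + o) = c * b ^ N.of_nat o * b ^ N.of_nat l.
  by rewrite addnC Nat2N.inj_add N.pow_add_r N.mul_assoc.
by rewrite -N.Div0.mul_mod_idemp_l H N.Div0.mul_mod_idemp_l.
Qed.

Definition residue_lifts (M k r : N) : seq N :=
  [seq r + M * N.of_nat i | i <- iota 0 (N.to_nat k)].

Lemma residue_liftsP M k x : k <> 0 ->
  x mod (M * k) \in residue_lifts M k (x mod M).
Proof.
(* The index of the lift is the next digit of [x] in mixed radix: [x mod (M * k) = x mod M + M * ((x
   / M) mod k)]. *)
move=> k0; apply/mapP; exists (N.to_nat ((x / M) mod k)).
  by rewrite mem_iota /=; have := N.mod_lt (x / M) k k0; lia.
by rewrite N2Nat.id N.Div0.mod_mul_r.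
Qed.

Lemma mod_mod_dvd (x a b : N) : a mod b = 0 -> (x mod a) mod b = x mod b.
Proof.
move=> /N.Lcm0.mod_divide [q ->].
by rewrite N.mul_comm N.Div0.mod_mul_r N.mul_comm N.Div0.mod_add N.Div0.mod_mod.
Qed.

Lemma to_nat_mod (x : nat) (k : N) : k <> 0 ->
    N.to_nat (N.of_nat x mod k) = (x %% N.to_nat k)%N.
Proof.
move=> k0; have := N.div_mod (N.of_nat x) k k0.
have := N.mod_lt (N.of_nat x) k k0.
set q := (_ / _); set r := (_ mod _) => ltr /(congr1 N.to_nat).
rewrite Nat2N.id => ->.
rewrite N2Nat.inj_add N2Nat.inj_mul plusE multE mulnC modnMDl.
by rewrite modn_small //; lia.
Qed.

End Residues.

(** * The sieve on pairs of residue classes *)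

Section Sieve.

Local Open Scope N_scope.

Variables b c d e : N.

(* A certificate entry (m, T, o) asserts that modulo m the Padovan sequence has
   period T and l |-> c * b ^ l has period o.  For m dividing c this holds with
   o = 1: such an entry expresses that P_n + d = e modulo m. *)
Definition sieve_step (M L : N) (S : seq (N * N)) (m T o : N) :
    option (N * N * seq (N * N)) :=
  let pt := padovan_table m (N.to_nat T + 3) (1 mod m) (1 mod m) (1 mod m) in
  let gt := geometric_table m b (N.to_nat o).+1 (c mod m) in
  let kn := T / N.gcd M T in
  let kl := o / N.gcd L o in
  if [&& drop (N.to_nat T) pt == take 3 pt, nth 0 gt (N.to_nat o) == nth 0 gt 0,
         0 <? kn, 0 <? kl, (M * kn) mod T =? 0 & (L * kl) mod o =? 0]
  then Some (M * kn, L * kl,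
    [seq x <- [seq (x.1, l) | x <- [seq (n, x.2) | x <- S,
                                     n <- residue_lifts M kn x.1],
                              l <- residue_lifts L kl x.2]
     | (nth 0 pt (N.to_nat (x.1 mod T)) + d) mod m
       =? (nth 0 gt (N.to_nat (x.2 mod o)) + e) mod m])
  else None.

(** Certificates are untrusted: a wrong period makes the step fail, and success means that no pair
    of classes survives. *)
Fixpoint sieve (M L : N) (S : seq (N * N)) (cert : seq (N * N * N)) : bool :=
  match cert with
  | [::] => nilp S
  | (m, T, o) :: cert' =>
      if sieve_step M L S m T o is Some (M', L', S')
      then sieve M' L' S' cert' else false
  end.

(** The invariant of the sieve; for empty [S] it says that there is no solution. *)
Definition sieve_covers (M L : N) (S : seq (N * N)) : Prop :=
  forall n l : nat, padovanN n + d = c * b ^ N.of_nat l + e ->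
    (N.of_nat n mod M, N.of_nat l mod L) \in S.

Lemma sieve_step_covers M L S m T o M' L' S' :
  sieve_step M L S m T o = Some (M', L', S') ->
  sieve_covers M L S -> sieve_covers M' L' S'.
Proof.
rewrite /sieve_step; set pt := padovan_table _ _ _ _ _.
set gt := geometric_table _ _ _ _; set kn := T / _; set kl := o / _.
(* The new moduli are meant to be lcm(M, T) and lcm(L, o), but only the positivity and divisibility
   tested at run time are used. *)
case: ifP => // /andP[/eqP ptT /and5P[/eqP gto]].
move=> /N.ltb_lt kn0 /N.ltb_lt kl0 /N.eqb_eq MT /N.eqb_eq Lo.
case=> <- <- <- cov n l sol.
have T0 : 0 < T by move: kn0; rewrite /kn; case: (T).
have o0 : 0 < o by move: kl0; rewrite /kl; case: (o).
have nth_pt j : (j < N.to_nat T + 3)%N -> nth 0 pt j = padovanN j mod m.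
  exact: (@nth_padovan_table m _ 0).
have nth_gt j : (j < (N.to_nat o).+1)%N ->
    nth 0 gt j = (c * b ^ N.of_nat j) mod m.
  exact: nth_geometric_table.
(* The table has [T + 3] entries, so [drop] leaves exactly the terms of index [T], [T + 1], [T + 2],
   which [ptT] compares with the first three. *)
have perP : padovanN n mod m = padovanN (n %% N.to_nat T)%N mod m.
  apply: padovan_residue_period => i lti.
  rewrite -!nth_pt; try lia.
  by rewrite -nth_drop ptT nth_take.
have perG : (c * b ^ N.of_nat l) mod m =
            (c * b ^ N.of_nat (l %% N.to_nat o)%N) mod m.
  apply: geometric_residue_period.
  by rewrite -nth_gt // gto nth_gt // N.mul_1_r.
rewrite mem_filter /= !mod_mod_dvd // !to_nat_mod; try lia.
have ltT : (n %% N.to_nat T < N.to_nat T)%N by rewrite ltn_mod; lia.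
have lto : (l %% N.to_nat o < N.to_nat o)%N by rewrite ltn_mod; lia.
rewrite nth_pt; last by lia.
rewrite nth_gt; last by lia.
rewrite -perP -perG !N.Div0.add_mod_idemp_l sol N.eqb_refl /=.
(* The lift is made in two stages; in this intermediate pair only the class of [n] has been
   refined. *)
apply/allpairsPdep; exists (N.of_nat n mod (M * kn), N.of_nat l mod L).
exists (N.of_nat l mod (L * kl)).
split=> //=; last by apply: residue_liftsP; lia.
apply/allpairsPdep; exists (N.of_nat n mod M, N.of_nat l mod L).
exists (N.of_nat n mod (M * kn)); split=> //=; first exact: cov.
by apply: residue_liftsP; lia.
Qed.

Lemma sieve_sound M L S cert : sieve M L S cert -> sieve_covers M L S ->
  forall n l : nat, padovanN n + d <> c * b ^ N.of_nat l + e.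
Proof.
elim: cert M L S => [|[[m T] o] cert IH] M L S /=.
  by move=> /nilP -> cov n l /cov.
case E: sieve_step => [[[M' L'] S']|//] ok /(sieve_step_covers E).
exact: IH.
Qed.

End Sieve.

(** * Small exponents and certificates *)

Lemma leq_padovan m n : m <= n -> padovan m <= padovan n.
Proof.
(* Three consecutive inequalities are carried along: adding the first two termwise yields the next
   one. *)
suff mono k : [/\ padovan k <= padovan k.+1, padovan k.+1 <= padovan k.+2
                & padovan k.+2 <= padovan k.+3].
  by apply: (homo_leq (leqnn) (leq_trans)) => k; case: (mono k).
elim: k => [|k [IH0 IH1 IH2]]; first by [].
by split=> //; rewrite (padovan_rec k.+1) (padovan_rec k) leq_add.
Qed.

(* The exponents l >= l0 are excluded by the sieve, applied to l - l0; for the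
   others, the right-hand side is below padovan 28 = 1897. *)
Definition certificate_ok (sols : seq (nat * nat * nat)) (d e c b l0 : nat)
    (cert : seq (N * N * N)) : bool :=
  [&& sieve (N.of_nat b) (N.of_nat c * N.of_nat b ^ N.of_nat l0)%num
        (N.of_nat d) (N.of_nat e) 1%num 1%num [:: (0, 0)%num] cert
    & all (fun l => (c * b ^ l + e < padovan 28) &&
        all (fun n => (padovan n + d == c * b ^ l + e) ==> ((n, b, l) \in sols))
          (iota 0 28)) (iota 1 l0.-1)].

Lemma certificate_ok_sound sols d e c b l0 cert :
  certificate_ok sols d e c b l0 cert ->
  forall n l, 1 <= l -> padovan n + d = c * b ^ l + e -> (n, b, l) \in sols.
Proof.
move=> /andP[siev small] n l l1 sol; case: (ltnP l l0) => ll0.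
  have /(allP small) /andP[lt28 /allP ok] : l \in iota 1 l0.-1.
    by rewrite mem_iota; lia.
  apply: (implyP (ok n _)); last by rewrite sol.
  (* Here P_n is at most the right-hand side, hence [n < 28]. Over all the tables the largest such
     value is 7 * 6^3 + 1 = 1513, which lies between P_27 = 1432 and P_28. *)
  rewrite mem_iota /= add0n ltnNge; apply/negP => /leq_padovan le28.
  by move: lt28; rewrite -sol ltnNge (leq_trans le28) ?leq_addr.
case: (@sieve_sound _ _ _ _ _ _ _ _ siev _ n (l - l0)).
  (* Modulo 1 the only pair of classes is (0, 0), so the initial set covers everything. *)
  by move=> ? ?; rewrite !N.mod_1_r.
have to_pow x y : N.of_nat (x ^ y) = (N.of_nat x ^ N.of_nat y)%num.
  by elim: y => // y IH; rewrite expnS Nat2N.inj_succ N.pow_succ_r' -IH; lia.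
rewrite -N.mul_assoc -N.pow_add_r -Nat2N.inj_add (_ : (l0 + _)%coq_nat = l).
  by rewrite -to_pow /padovanN; lia.
by lia.
Qed.

(* In this table and the next three, the entry for base b is the pair of l0 and
   the list of moduli, at index b - 2. *)
Definition thabit1_certificates : seq (nat * seq (N * N * N)) :=
  [:: (9%N, [:: (512, 1792, 1); (7, 48, 3); (5, 24, 4); (17, 288, 8);
           (11, 120, 10); (181, 10920, 180)]);
      (2%N, [:: (9, 39, 1); (4, 14, 2); (16, 56, 4); (32, 112, 8); (5, 24, 4);
           (7, 48, 6)]);
      (2%N, [:: (16, 56, 1); (5, 24, 2); (7, 48, 3); (49, 336, 21);
           (449, 224, 112)]);
      (1%N, [:: (5, 24, 1); (7, 48, 6); (16, 56, 4); (449, 224, 14)]);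
      (2%N, [:: (9, 39, 1); (5, 24, 1); (7, 48, 2)]);
      (1%N, [:: (7, 48, 1); (5, 24, 4); (25, 120, 4); (8, 28, 2)]);
      (2%N, [:: (16, 56, 1); (7, 48, 1); (5, 24, 4); (9, 39, 2)]);
      (2%N, [:: (27, 117, 1); (5, 24, 2); (16, 56, 2); (7, 48, 3);
           (19, 180, 9); (181, 10920, 45)]);
      (1%N, [:: (5, 24, 1); (11, 120, 2); (7, 48, 6); (19, 180, 18)])]%num.

Definition thabit2_certificates : seq (nat * seq (N * N * N)) :=
  [:: (9%N, [:: (512, 1792, 1); (7, 48, 3); (5, 24, 4); (17, 288, 8);
           (19, 180, 18); (11, 120, 10); (181, 10920, 180)]);
      (3%N, [:: (27, 117, 1); (8, 28, 2); (16, 56, 4); (5, 24, 4);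
           (25, 120, 20); (181, 10920, 45); (19, 180, 18); (11, 120, 5)]);
      (2%N, [:: (16, 56, 1); (5, 24, 2); (7, 48, 3); (49, 336, 21);
           (449, 224, 112)]);
      (3%N, [:: (125, 600, 1); (11, 120, 5)]);
      (4%N, [:: (16, 56, 1); (5, 24, 1); (7, 48, 2)]);
      (1%N, [:: (7, 48, 1); (5, 24, 4)]);
      (2%N, [:: (32, 112, 1); (7, 48, 1); (5, 24, 4)]);
      (2%N, [:: (81, 351, 1); (271, 270, 15); (11, 120, 5); (181, 10920, 45)]);
      (1%N, [:: (5, 24, 1); (11, 120, 2); (7, 48, 6); (19, 180, 18);
           (271, 270, 5)])]%num.

Definition williams1_certificates : seq (nat * seq (N * N * N)) :=
  [:: (5%N, [:: (32, 112, 1); (7, 48, 3); (49, 336, 21); (5, 24, 4);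
           (3361, 3360, 168)]);
      (3%N, [:: (27, 117, 1); (8, 28, 2); (5, 24, 4); (7, 48, 6);
           (19, 180, 18); (181, 10920, 45)]);
      (5%N, [:: (512, 1792, 1); (5, 24, 2); (17, 288, 4); (7, 48, 3)]);
      (1%N, [:: (5, 24, 1); (4, 14, 1); (16, 56, 4)]);
      (4%N, [:: (16, 56, 1); (5, 24, 1); (7, 48, 2); (49, 336, 14);
           (11, 120, 10); (211, 210, 105)]);
      (1%N, [:: (7, 48, 1); (5, 24, 4); (25, 120, 4); (11, 120, 10)]);
      (2%N, [:: (16, 56, 1); (7, 48, 1); (5, 24, 4)]);
      (2%N, [:: (27, 117, 1); (5, 24, 2); (4, 14, 1); (7, 48, 3); (19, 180, 9);
           (181, 10920, 45)]);
      (1%N, [:: (5, 24, 1); (11, 120, 2)])]%num.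

Definition williams2_certificates : seq (nat * seq (N * N * N)) :=
  [:: (7%N, [:: (128, 448, 1); (7, 48, 3); (5, 24, 4); (17, 288, 8);
           (19, 180, 18); (11, 120, 10); (181, 10920, 180)]);
      (2%N, [:: (9, 39, 1); (8, 28, 2); (5, 24, 4); (7, 48, 6); (49, 336, 42);
           (211, 210, 210); (181, 10920, 45)]);
      (5%N, [:: (512, 1792, 1); (5, 24, 2); (7, 48, 3); (49, 336, 21);
           (3361, 3360, 84)]);
      (2%N, [:: (25, 120, 1); (11, 120, 5); (7, 48, 6); (16, 56, 4)]);
      (4%N, [:: (16, 56, 1); (5, 24, 1); (7, 48, 2); (11, 120, 10);
           (25, 120, 5); (211, 210, 105)]);
      (1%N, [:: (7, 48, 1); (5, 24, 4)]);
      (2%N, [:: (16, 56, 1); (7, 48, 1); (5, 24, 4)]);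
      (1%N, [:: (9, 39, 1); (5, 24, 2); (32, 112, 4); (7, 48, 3);
           (49, 336, 21); (211, 210, 105); (181, 10920, 45)]);
      (2%N, [:: (25, 120, 1); (11, 120, 2); (7, 48, 6)])]%num.

(** * From the certificates to the four families *)

Definition certificates_ok sols d e (c : nat -> nat) certs : bool :=
  all (fun b => let: (l0, cert) := nth (0, [::]) certs (b - 2) in
    certificate_ok sols d e (c b) b l0 cert) (iota 2 9).

Lemma certificates_ok_sound sols d e c certs :
  certificates_ok sols d e c certs ->
  forall n b l, 2 <= b <= 10 -> 1 <= l ->
  padovan n + d = c b * b ^ l + e -> (n, b, l) \in sols.
Proof.
move=> /allP ok n b l b_small l1 sol.
have /ok : b \in iota 2 9 by rewrite mem_iota; lia.
by case: nth => l0 cert /certificate_ok_sound; apply.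
Qed.

(** The certificates show that every solution is listed, and direct evaluation that every listed
    triple is a solution; the set of values follows. Adding [d] avoids truncated subtraction of the
    final 1, and [undup] merges repeated values such as P_0 = P_1 = P_2. *)
Lemma padovan_family f d e c certs sols vals :
  (forall b l, 2 <= b -> f b l + d = c b * b ^ l + e) ->
  all (fun s => [&& 2 <= s.1.2 <= 10, 1 <= s.2 & padovan s.1.1 == f s.1.2 s.2])
      sols ->
  undup [seq padovan s.1.1 | s <- sols] = vals ->
  certificates_ok sols d e c certs ->
  (forall n b l, 2 <= b <= 10 -> 1 <= l ->
     (padovan n = f b l <-> (n, b, l) \in sols)) /\
  (forall m, is_value_small_base f m /\ is_padovan m <-> m \in vals).
Proof.
move=> fE /allP sols_ok <- /certificates_ok_sound ok.
have solP n b l : 2 <= b <= 10 -> 1 <= l ->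
    (padovan n = f b l <-> (n, b, l) \in sols).
  move=> b_small l1; split=> [nE|/sols_ok/and3P[_ _ /eqP] //].
  by apply: ok => //; rewrite nE; apply: fE; case/andP: b_small.
split=> // m; rewrite mem_undup; split.
  case=> -[b [l [b_small l1 mE]]] [n nE].
  by apply/mapP; exists (n, b, l) => //; apply/solP; rewrite // -nE.
case/mapP=> -[[n b] l] /sols_ok /and3P[/= b_small l1 /eqP nE] ->.
by split; [exists b, l | exists n].
Qed.

Theorem theorem3p1 :
  [/\
    (forall n b l : nat, 2 <= b <= 10 -> 1 <= l ->
       (padovan n = thabit1 b l <->
        (n, b, l) \in [:: (7, 2, 1)])) /\
    (forall m : nat,
       (is_value_small_base thabit1 m /\ is_padovan m <->
        m \in [:: 5])),
    (forall n b l : nat, 2 <= b <= 10 -> 1 <= l ->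
       (padovan n = thabit2 b l <->
        (n, b, l) \in [:: (8, 2, 1); (12, 4, 1); (14, 3, 2); (15, 2, 4); (19, 5, 2)])) /\
    (forall m : nat,
       (is_value_small_base thabit2 m /\ is_padovan m <->
        m \in [:: 7; 21; 37; 49; 151])),
    (forall n b l : nat, 2 <= b <= 10 -> 1 <= l ->
       (padovan n = williams1 b l <->
        (n, b, l) \in [:: (0, 2, 1); (1, 2, 1); (2, 2, 1); (5, 2, 2); (7, 3, 1);
                          (8, 2, 3)])) /\
    (forall m : nat,
       (is_value_small_base williams1 m /\ is_padovan m <->
        m \in [:: 1; 3; 5; 7])) &
    (forall n b l : nat, 2 <= b <= 10 -> 1 <= l ->
       (padovan n = williams2 b l <->
        (n, b, l) \in [:: (5, 2, 1); (7, 2, 2); (8, 3, 1); (9, 2, 3); (12, 5, 1);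
                          (15, 4, 2); (16, 2, 6); (26, 6, 3)])) /\
    (forall m : nat,
       (is_value_small_base williams2 m /\ is_padovan m <->
        m \in [:: 3; 5; 7; 9; 21; 49; 65; 1081]))
  ].
Proof.
split.
- apply: (@padovan_family _ 1 0 (addn^~ 1) thabit1_certificates);
    [|by []|by []|by vm_compute].
  (* Adding 1 back cancels the truncated subtraction because the product is positive. *)
  move=> b l b2; rewrite /thabit1 addn0 subnK // muln_gt0 addn1.
  by rewrite expn_gt0; lia.
- apply: (@padovan_family _ 0 1 (addn^~ 1) thabit2_certificates);
    [|by []|by []|by vm_compute].
  by move=> b l _; rewrite addn0.
- apply: (@padovan_family _ 1 0 (subn^~ 1) williams1_certificates);
    [|by []|by []|by vm_compute].
  (* Here positivity of the product also needs [b - 1 > 0], which is [b2]. *)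
  move=> b l b2; rewrite /williams1 addn0 subnK // muln_gt0 subn_gt0 b2.
  by rewrite expn_gt0; lia.
- apply: (@padovan_family _ 0 1 (subn^~ 1) williams2_certificates);
    [|by []|by []|by vm_compute].
  by move=> b l _; rewrite addn0.
Qed.
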